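(* Let $\mathfrak g$ be a special Banach--Malcev algebra over $\mathbb K\in\{\mathbb R,\mathbb C\}$ with norm $\|\cdot\|$, and let $B<\infty$ be a constant such that $\|[x,y]\|\le B\|x\|\|y\|$ for all $x,y\in\mathfrak g$. Let $K\ge 1$ be a uniform bound on the absolute values of the BCH coefficients, i.e. $|\alpha_T|\le K$ for all trees $T$. Then for all $x,y\in\mathfrak g$ with $$B(\|x\|+\|y\|)<\frac{1}{4K},$$ the BCH series $\mathrm{BCH}(x,y)=\sum_{n\ge1}Z_n(x,y)$ converges absolutely in norm. Equivalently, for any $r\in(0,1/(4K))$, the series converges absolutely for every $(x,y)$ in the diamond $\{(x,y)\in\mathfrak g\times\mathfrak g: B(\|x\|+\|y\|)\le r\}$.
   Context: A Malcev algebra over $\mathbb K\in\{\mathbb R,\mathbb C\}$ is a vector space with a bilinear bracket satisfying $[x,y]=-[y,x]$ and $[[x,y],[x,z]]=[[[x,y],z],x]+[[[y,z],x],x]+[[[z,x],x],y]$. A Banach--Malcev algebra is a Malcev algebra complete for a norm making the bracket continuous. It is special if there is an alternative algebra $\mathcal A$ and an injective linear map $\mathfrak g\hookrightarrow\mathcal A$ under which the bracket of $\mathfrak g$ becomes the commutator $[x,y]=xy-yx$ of $\mathcal A$. The BCH series is understood as $\mathrm{BCH}(x,y)=\log(\exp(x)\exp(y))$ in $\mathcal A$ (a unit being adjoined if necessary), expanded into homogeneous components: $Z_n(x,y)$ is the part of total degree $n$ in $(x,y)$, i.e. the coefficient of $s^n$ in the formal series $\log(\exp(sx)\exp(sy))$.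 Thus $\mathrm{BCH}(x,y)=x+y+\tfrac12[x,y]+\tfrac1{12}[x,[x,y]]-\tfrac1{12}[y,[x,y]]+\cdots$. The components are written as $$Z_n(x,y)=\sum_{T\in\mathcal T_n}\alpha_T\,[x,y]_T,$$ where $\mathcal T_n$ is the set of full (planar) binary trees with $n$ leaves, each leaf labeled by $x$ or $y$; $[x,y]_T\in\mathfrak g$ is the iterated bracket prescribed by $T$ (a single leaf gives its label; a tree with left and right subtrees $T_L,T_R$ gives $[[x,y]_{T_L},[x,y]_{T_R}]$); and $\alpha_T\in\mathbb Q$ are the (fixed) classical BCH coefficients. Absolute convergence in norm means $\sum_{n\ge1}\|Z_n(x,y)\|<\infty$. *)

(* Defs.v *)
From HB Require Import structures.
From mathcomp Require Import all_boot all_order all_algebra.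
From mathcomp Require Import all_classical all_reals all_analysis.
From mathcomp Require Import complex.

Set Implicit Arguments.
Unset Strict Implicit.
Unset Printing Implicit Defensive.

Import Order.TTheory GRing.Theory Num.Theory.
Import numFieldNormedType.Exports.

Local Open Scope classical_set_scope.
Local Open Scope ring_scope.

Variant scalar_kind := RealScalars | ComplexScalars.

Definition scalar_field (R : realType) (k : scalar_kind) : numFieldType :=
  match k with RealScalars => R | ComplexScalars => R[i]%C end.

Definition scalar_re (R : realType) (k : scalar_kind) : scalar_field R k -> R :=
  match k return scalar_field R k -> R with
  | RealScalars => fun z => z
  | ComplexScalars => fun z => complex.Re z
  end.

(* The norm of a [normedModType F] takes its values in [F]; over the complex
   numbers these values are nonnegative reals, which [scalar_re] reads back
   in [R]. *)
Definition rnorm (R : realType) (k : scalar_kind)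
    (g : normedModType (scalar_field R k)) (x : g) : R :=
  scalar_re `|x|.

Section Algebras.
Variable F : fieldType.

Definition malcev (g : lmodType F) (br : g -> g -> g) : Prop :=
  [/\ bilinear_for *:%R *:%R br,
      forall x y, br x y = - br y x
    & forall x y z, br (br x y) (br x z) =
        br (br (br x y) z) x + br (br (br y z) x) x + br (br (br z x) x) y].

Definition alternative (A : lmodType F) (mul : A -> A -> A) : Prop :=
  [/\ bilinear_for *:%R *:%R mul,
      forall x y, mul (mul x x) y = mul x (mul x y)
    & forall x y, mul (mul y x) x = mul y (mul x x)].

Definition commutator_bracket (A : lmodType F) (mul : A -> A -> A) (x y : A) : A :=
  mul x y - mul y x.

Definition special_embedding (g : lmodType F) (br : g -> g -> g)
    (A : lmodType F) (mul : A -> A -> A) (iota : {linear g -> A}) : Prop :=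
  [/\ alternative mul, injective iota
    & forall x y, iota (br x y) = commutator_bracket mul (iota x) (iota y)].

Definition unitization (A : lmodType F) : lmodType F := (F^o * A)%type.

Definition unitization_mul (A : lmodType F) (mul : A -> A -> A)
    (u v : unitization A) : unitization A :=
  (u.1 * v.1, u.1 *: v.2 + v.1 *: u.2 + mul u.2 v.2).

Definition unitization_one (A : lmodType F) : unitization A := (1, 0).

Definition unitization_in (A : lmodType F) (a : A) : unitization A := (0, a).

End Algebras.

(* Formal power series in [s] over a unital, not necessarily associative,
   algebra; [f n] is the coefficient of [s^n]. *)
Section FormalSeries.
Variables (F : fieldType) (V : lmodType F) (mul : V -> V -> V) (one : V).

Definition fps_one : nat -> V := fun n => if n == 0%N then one else 0.

Definition fps_mul (f g : nat -> V) : nat -> V :=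
  fun n => \sum_(i < n.+1) mul (f i) (g (n - i)%N).

Definition fps_pow (f : nat -> V) (m : nat) : nat -> V :=
  iter m (fps_mul f) fps_one.

(* [exp (s x)] *)
Definition fps_exp (x : V) : nat -> V :=
  fun n => (n`!%:R)^-1 *: iter n (mul x) one.

(* For [f] with constant term [one], [f - 1] is divisible by [s], so that the
   powers of exponent [m > n] do not contribute to the coefficient of [s^n]. *)
Definition fps_log (f : nat -> V) : nat -> V :=
  fun n => \sum_(1 <= m < n.+1)
    ((-1) ^+ m.+1 / m%:R) *: fps_pow (fun j => f j - fps_one j) m n.

Definition log_exp_exp (x y : V) : nat -> V :=
  fps_log (fps_mul (fps_exp x) (fps_exp y)).

End FormalSeries.

Inductive btree := LeafX | LeafY | Node of btree & btree.

HB.instance Definition _ := gen_eqMixin btree.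
HB.instance Definition _ := gen_choiceMixin btree.

Fixpoint leaves (T : btree) : nat :=
  match T with Node l r => (leaves l + leaves r)%N | _ => 1%N end.

Fixpoint tree_bracket (V : Type) (br : V -> V -> V) (x y : V) (T : btree) : V :=
  match T with
  | LeafX => x
  | LeafY => y
  | Node l r => br (tree_bracket br x y l) (tree_bracket br x y r)
  end.

Lemma leaves_gt0 T : (0 < leaves T)%N.
Proof. by elim: T => //= l lP r _; rewrite addn_gt0 lP. Qed.

(* The finitely supported sum in [tree_component] is the plain sum over all
   the trees with [n] leaves. *)
Lemma finite_trees n : finite_set [set T | leaves T = n].
Proof.
suff H m : finite_set [set T | (leaves T <= m)%N].
  by apply: (sub_finite_set _ (H n)) => T /= ->.
elim: m => [|m IH].
  rewrite (_ : [set T | _] = set0) //; apply/seteqP; split=> T //=.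
  by rewrite leqNgt leaves_gt0.
pose S := [set T | (leaves T <= m)%N].
have fS : finite_set ([set LeafX; LeafY] `|`
    (fun p => Node p.1 p.2) @` (S `*` S)).
  by rewrite finite_setU; split=> //; apply/finite_image/finite_setX.
apply: sub_finite_set fS => -[||l r] /= lr; [by left; left|by left; right|].
right; exists (l, r) => //; split; rewrite /S /= -ltnS.
  by apply: leq_trans lr; rewrite -addn1 leq_add2l leaves_gt0.
by apply: leq_trans lr; rewrite -add1n leq_add2r leaves_gt0.
Qed.

Definition tree_component (F : fieldType) (V : lmodType F)
    (br : V -> V -> V) (alpha : btree -> rat) (n : nat) (x y : V) : V :=
  \sum_(T \in [set T | leaves T = n])
     (ratr (alpha T) : F) *: tree_bracket br x y T.

(* A representation of the BCH series by iterated brackets is not unique (the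
   brackets of trees are linearly dependent). A family of coefficients is one
   of BCH when it represents the series universally in the associative
   setting; this covers every classical choice, such as Dynkin's. *)
Definition BCH_coefficients (alpha : btree -> rat) : Prop :=
  forall (A : algType rat) (x y : A) (n : nat), (0 < n)%N ->
    log_exp_exp *%R 1 x y n =
    tree_component (commutator_bracket *%R) alpha n x y.

(* The [n]-th homogeneous component is the coefficient of [s^n] in
   [log (exp (s x) exp (s y))], computed in the alternative algebra with a unit
   adjoined; it is the image of the element [tree_component br alpha n x y]
   of [g], and it is there that norms are taken. *)
Definition BCH_converges_absolutely (R : realType) (k : scalar_kind)
    (g : normedModType (scalar_field R k)) (br : g -> g -> g)
    (A : lmodType (scalar_field R k)) (mul : A -> A -> A) (iota : g -> A)
    (alpha : btree -> rat) (x y : g) : Prop :=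
  (forall n, (0 < n)%N ->
     unitization_in (iota (tree_component br alpha n x y)) =
     log_exp_exp (unitization_mul mul) (unitization_one A)
       (unitization_in (iota x)) (unitization_in (iota y)) n) /\
  (\sum_(1 <= n <oo) (rnorm (tree_component br alpha n x y))%:E < +oo)%E.

(* Main.v *)
Require Import Defs.
From HB Require Import structures.
From mathcomp Require Import all_boot all_order all_algebra.
From mathcomp Require Import all_classical all_reals all_analysis.
From mathcomp Require Import complex.

From mathcomp Require Import zify lra.

Set Implicit Arguments.
Unset Strict Implicit.

Import Order.TTheory GRing.Theory Num.Theory.
Import numFieldNormedType.Exports.

Local Open Scope classical_set_scope.
Local Open Scope ring_scope.

(** Two things have to be shown: the brackets of trees do compute the series
log (exp x exp y) of the alternative algebra, and the series converges.

The coefficients [alpha] are known to represent the series in associative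
algebras only.  They represent it in every unital alternative algebra because
of Artin's theorem: two elements [x], [y] generate an associative subalgebra.
The span of the unit and of the words in [x], [y] is thus an associative
algebra over the rationals in which the hypothesis on [alpha] applies, and the
inclusion of this span carries both sides to the ambient algebra
([BCH_alternative]).  Since the unitization of an alternative algebra is
alternative and the embedding of g turns brackets into commutators, the
brackets taken in g are mapped to the components of the series
([special_BCH]).

Artin's theorem is proved by induction on the total length of three words
([short_words_associateP]).  Shorter words associate, so each of the three words
is a generator or starts with one, and by the pigeonhole principle two of them
start with the same generator [l].  As the associator is alternating, it is
enough to treat [(l q, l r, p)], and the polarized Moufang identity
[(x, w a, z) + (w, x a, z) = (x, a, z) w + (w, a, z) x] expresses it by
associators of shorter words.

For the convergence, let [C > 0] dominate [B] with
[t := C (|x| + |y|) <= 1/4].  The weight [w T := C |[x,y]_T|] satisfies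
[w (Node l r) <= w l * w r], so the sum [P n] of the weights of the trees of
height less than [n] obeys [P (n+1) <= t + P n ^ 2], whence [P n <= 1/2] for all
[n].  The sum of [|Z_n|] is therefore at most [K / (2 C)]; this replaces the
estimate of the Catalan numbers by powers of 4 ([tree_components_summable]). *)

(** * Bilinear products *)

Section BilinearProduct.
Variables (F : fieldType) (V : lmodType F) (mul : V -> V -> V).
Hypothesis mul_bilinear : bilinear_for *:%R *:%R mul.

Local Infix "∙" := mul (at level 40, left associativity).

Lemma bilinPl k u v w : (k *: u + v) ∙ w = k *: (u ∙ w) + v ∙ w.
Proof. by have [bl _] := mul_bilinear; apply: (bl w). Qed.

Lemma bilinPr k u v w : w ∙ (k *: u + v) = k *: (w ∙ u) + w ∙ v.
Proof. by have [_ br] := mul_bilinear; apply: (br w). Qed.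

Lemma bilinDl u v w : (u + v) ∙ w = u ∙ w + v ∙ w.
Proof. by have := bilinPl 1 u v w; rewrite !scale1r. Qed.

Lemma bilinDr u v w : w ∙ (u + v) = w ∙ u + w ∙ v.
Proof. by have := bilinPr 1 u v w; rewrite !scale1r. Qed.

Lemma bilin0l w : 0 ∙ w = 0.
Proof. by apply: (addrI (0 ∙ w)); rewrite -bilinDl !addr0. Qed.

Lemma bilin0r w : w ∙ 0 = 0.
Proof. by apply: (addrI (w ∙ 0)); rewrite -bilinDr !addr0. Qed.

Lemma bilinNl u w : (- u) ∙ w = - (u ∙ w).
Proof. by apply: (addrI (u ∙ w)); rewrite -bilinDl !subrr bilin0l. Qed.

Lemma bilinNr u w : w ∙ (- u) = - (w ∙ u).
Proof. by apply: (addrI (w ∙ u)); rewrite -bilinDr !subrr bilin0r. Qed.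

Lemma bilinZl k u w : (k *: u) ∙ w = k *: (u ∙ w).
Proof. by have := bilinPl k u 0 w; rewrite bilin0l !addr0. Qed.

Lemma bilinZr k u w : w ∙ (k *: u) = k *: (w ∙ u).
Proof. by have := bilinPr k u 0 w; rewrite bilin0r !addr0. Qed.

End BilinearProduct.

(** * Alternative algebras and the Moufang identity *)

Section AlternativeAlgebra.
Variables (F : fieldType) (V : lmodType F) (mul : V -> V -> V).
Hypothesis mul_alt : alternative mul.

Local Infix "∙" := mul (at level 40, left associativity).

Let mul_bilinear : bilinear_for *:%R *:%R mul.
Proof. by have [] := mul_alt. Qed.

Let alt_mulPl := bilinPl mul_bilinear.
Let alt_mulPr := bilinPr mul_bilinear.
Let alt_mulDl := bilinDl mul_bilinear.
Let alt_mulDr := bilinDr mul_bilinear.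
Let alt_mul0l := bilin0l mul_bilinear.
Let alt_mul0r := bilin0r mul_bilinear.
Let alt_mulNl := bilinNl mul_bilinear.
Let alt_mulNr := bilinNr mul_bilinear.
Let alt_mulE := (alt_mulDl, alt_mulDr, alt_mulNl, alt_mulNr).

Definition associator (a b c : V) : V := (a ∙ b) ∙ c - a ∙ (b ∙ c).

Lemma associatorPl k u v b c :
  associator (k *: u + v) b c = k *: associator u b c + associator v b c.
Proof. by rewrite /associator !alt_mulPl scalerBr opprD addrACA. Qed.

Lemma associatorPm k u v a c :
  associator a (k *: u + v) c = k *: associator a u c + associator a v c.
Proof.
by rewrite /associator alt_mulPr !alt_mulPl alt_mulPr scalerBr opprD addrACA.
Qed.

Lemma associatorPr k u v a b :
  associator a b (k *: u + v) = k *: associator a b u + associator a b v.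
Proof. by rewrite /associator !alt_mulPr scalerBr opprD addrACA. Qed.

Lemma associatorDl u v b c :
  associator (u + v) b c = associator u b c + associator v b c.
Proof. by have := associatorPl 1 u v b c; rewrite !scale1r. Qed.

Lemma associatorDm u v a c :
  associator a (u + v) c = associator a u c + associator a v c.
Proof. by have := associatorPm 1 u v a c; rewrite !scale1r. Qed.

Lemma associatorDr u v a b :
  associator a b (u + v) = associator a b u + associator a b v.
Proof. by have := associatorPr 1 u v a b; rewrite !scale1r. Qed.

Lemma associator_lalt a b : associator a a b = 0.
Proof. by have [_ la _] := mul_alt; rewrite /associator la subrr. Qed.

Lemma associator_ralt a b : associator b a a = 0.
Proof. by have [_ _ ra] := mul_alt; rewrite /associator ra subrr. Qed.

Lemma associator_swapl a b c : associator a b c = - associator b a c.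
Proof.
apply/eqP; rewrite -addr_eq0; apply/eqP.
have := associator_lalt (a + b) c.
by rewrite !(associatorDl, associatorDm) !associator_lalt add0r addr0.
Qed.

Lemma associator_swapr a b c : associator a b c = - associator a c b.
Proof.
apply/eqP; rewrite -addr_eq0; apply/eqP.
have := associator_ralt (b + c) a.
by rewrite !(associatorDr, associatorDm) !associator_ralt add0r addr0 addrC.
Qed.

Lemma associator_swap13 a b c : associator a b c = - associator c b a.
Proof. by rewrite associator_swapl associator_swapr opprK associator_swapl. Qed.

Lemma associator_flex a b : associator a b a = 0.
Proof. by rewrite associator_swapr associator_lalt oppr0. Qed.

(** This identity holds in any bilinear algebra, the terms cancelling in pairs;
alternativity turns its specializations into the Moufang identities below. *)
Lemma teichmuller w a b c :
  associator (w ∙ a) b c - associator w (a ∙ b) c + associator w a (b ∙ c) =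
  w ∙ associator a b c + associator w a b ∙ c.
Proof.
rewrite /associator !alt_mulE.
set p1 := w ∙ a ∙ b ∙ c; set p2 := w ∙ a ∙ (b ∙ c); set p3 := w ∙ (a ∙ b) ∙ c.
set p4 := w ∙ (a ∙ b ∙ c); set p5 := w ∙ (a ∙ (b ∙ c)).
rewrite opprB (addrC (p1 - p2)) -addrA (addrA (p1 - p2)) subrK.
by rewrite addrACA (addrC (- p3)) addrACA.
Qed.

Lemma associator0 a b c : associator a b c = 0 -> (a ∙ b) ∙ c = a ∙ (b ∙ c).
Proof. by move/eqP; rewrite subr_eq0 => /eqP. Qed.

(** Together with [associator_sqr] this computes the same associator in two
ways, from the instances of [teichmuller] with two equal neighbours. *)
Lemma associator_sql x a z :
  associator (x ∙ x) a z = associator x (x ∙ a) z + x ∙ associator x a z.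
Proof.
have := teichmuller x x a z.
rewrite !associator_lalt alt_mul0l !addr0 => <-.
by rewrite addrC subrK.
Qed.

Lemma associator_sqr x a z :
  associator (x ∙ x) a z = associator x (a ∙ x) z + associator x a z ∙ x.
Proof.
have := teichmuller z a x x.
rewrite !associator_ralt alt_mul0r !add0r.
rewrite !(associator_swap13 z) alt_mulNl opprK => /(congr1 -%R).
rewrite opprD !opprK => <-.
by rewrite [RHS]addrA subrr add0r.
Qed.

(** In the instance [x, a, x, z] of [teichmuller] the outer associators
[(x a, x, z)] and [(x, a, x z)] cancel, since [associator_sql] makes
[(x, x a, z)] antisymmetric in [a] and [z]. *)
Lemma moufang_middle x a z : associator x (a ∙ x) z = x ∙ associator x a z.
Proof.
have := teichmuller x a x z.
rewrite associator_flex alt_mul0l addr0 (associator_swapl a) alt_mulNr.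
rewrite (associator_swapl (x ∙ a)) (associator_swapr x a).
have -> : associator x (x ∙ z) a = - associator x (x ∙ a) z.
  apply: (addIr (x ∙ associator x z a)); rewrite -associator_sql.
  rewrite (associator_swapr x z a) alt_mulNr -opprD -associator_sql.
  by rewrite associator_swapr.
rewrite opprK addrAC addNr add0r => /(congr1 -%R).
by rewrite !opprK.
Qed.

(** Compare [associator_sql] with [associator_sqr]. *)
Lemma moufang_left x a z : associator x (x ∙ a) z = associator x a z ∙ x.
Proof.
apply: (addIr (x ∙ associator x a z)); rewrite -associator_sql.
by rewrite associator_sqr moufang_middle addrC.
Qed.

Lemma moufang_left_polarized x w a z :
  associator x (w ∙ a) z + associator w (x ∙ a) z =
  associator x a z ∙ w + associator w a z ∙ x.
Proof.
have := moufang_left (x + w) a z.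
rewrite alt_mulDl alt_mulDr !(associatorDl, associatorDm).
rewrite !(alt_mulDl (associator x a z)) !moufang_left.
move: (associator x (w ∙ a) z) (associator w (x ∙ a) z) (associator x a z ∙ w).
move: (associator w a z ∙ x) (associator x a z ∙ x) (associator w a z ∙ w).
move=> u p q U W v; rewrite -!addrA => /addrI; rewrite !addrA => /addIr ->.
exact: addrC.
Qed.

(** * Artin's theorem *)

Section Words.
Variables x y : V.
Local Notation word T := (tree_bracket mul x y T).

Definition letter (b : bool) : btree := if b then LeafX else LeafY.

Definition begins (b : bool) (T : btree) : Prop :=
  T = letter b \/
  exists2 T', leaves T = (leaves T').+1 & word T = word (letter b) ∙ word T'.

Definition short_words_associate (n : nat) : Prop :=
  forall T1 T2 T3, (leaves T1 + leaves T2 + leaves T3 <= n)%N ->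
    associator (word T1) (word T2) (word T3) = 0.

Lemma leaves_letter b : leaves (letter b) = 1%N.
Proof. by case: b. Qed.

(** Peel the leftmost leaf: [(l u) v = l (u v)] because these three words have
total length [leaves T]. *)
Lemma word_begins n T : short_words_associate n -> (leaves T <= n)%N ->
  exists b, begins b T.
Proof.
move=> IH; elim: T => [_|_|l IHl r _ /= le_n].
- by exists true; left.
- by exists false; left.
have [|b] := IHl; first by move: (leaves_gt0 r); lia.
case=> [->|[l' sz_l wl]]; exists b; right.
  by exists r; rewrite /= ?leaves_letter.
exists (Node l' r); rewrite /= ?sz_l // wl; apply: associator0.
by apply: IH; rewrite leaves_letter; lia.
Qed.

(** The inductive step of Artin's theorem.  In the main case [T1 = l q] and
[T2 = l r], the polarized Moufang identity at [x := l], [w := T1], [a := r]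
leaves [(l, T1 r, T3)], where [T1 r = l (q r)] by induction, so that
[moufang_left] shortens it once more. *)
Lemma associator_begins n b T1 T2 T3 : short_words_associate n ->
  (leaves T1 + leaves T2 + leaves T3 <= n.+1)%N ->
  begins b T1 -> begins b T2 -> associator (word T1) (word T2) (word T3) = 0.
Proof.
move=> IH le_n [->|[q sz_q wq]] [->|[r sz_r wr]].
- exact: associator_lalt.
- rewrite wr moufang_left IH ?alt_mul0l //.
  by move: (leaves_gt0 T1); rewrite leaves_letter; lia.
- rewrite associator_swapl wq moufang_left IH ?alt_mul0l ?oppr0 //.
  by move: (leaves_gt0 T2); rewrite leaves_letter; lia.
have := moufang_left_polarized (word (letter b)) (word T1) (word r) (word T3).
rewrite (IH (letter b)) ?leaves_letter; last by lia.
rewrite (IH T1) ?alt_mul0l ?addr0 -?wr; last by lia.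
have -> : word T1 ∙ word r = word (letter b) ∙ word (Node q r).
  rewrite wq; apply: associator0.
  by apply: IH; rewrite leaves_letter; move: (leaves_gt0 T3); lia.
rewrite moufang_left IH ?alt_mul0l ?add0r //=.
by rewrite leaves_letter; lia.
Qed.

Lemma short_words_associateP n : short_words_associate n.
Proof.
elim: n => [|n IH] T1 T2 T3 le_n; first by move: (leaves_gt0 T1); lia.
have [|b1 h1] := @word_begins n T1 IH.
  by move: (leaves_gt0 T2) (leaves_gt0 T3); lia.
have [|b2 h2] := @word_begins n T2 IH.
  by move: (leaves_gt0 T1) (leaves_gt0 T3); lia.
have [|b3 h3] := @word_begins n T3 IH.
  by move: (leaves_gt0 T1) (leaves_gt0 T2); lia.
(* two of the three first letters coincide *)
have [e12|ne12] := eqVneq b1 b2.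
  by rewrite -e12 in h2; apply: (associator_begins IH le_n h1 h2).
have [e13|ne13] := eqVneq b1 b3.
  rewrite -e13 in h3; rewrite associator_swapr.
  by rewrite (associator_begins IH _ h1 h3) ?oppr0 // addnAC.
have e23 : b3 = b2 by move: ne12 ne13; case: b1 b2 b3 {h1 h2 h3} => [] [] [].
rewrite e23 in h3; rewrite associator_swap13.
by rewrite (associator_begins IH _ h3 h2) ?oppr0 //; lia.
Qed.

Lemma word_associator T1 T2 T3 : associator (word T1) (word T2) (word T3) = 0.
Proof. exact: (@short_words_associateP _ T1 T2 T3 (leqnn _)). Qed.

End Words.
End AlternativeAlgebra.

(** * Associative subspaces as rational algebras *)

(** A subspace closed under a product that is associative there becomes an
associative unital algebra over the rationals: the characteristic being zero,
rational scalars act through [ratr].  This is the kind of algebra over which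
BCH coefficients are specified. *)
Section AssociativeSubalgebra.
Variables (F : numFieldType) (V : lmodType F) (mul : V -> V -> V) (one : V).

(** All hypotheses are fields of the record so that the algebra structures on
[subalg S] depend on [S] only, and can be inferred from the type. *)
Record associative_subalgebra := AssociativeSubalgebra {
  carrier : V -> Prop;
  carrier_one : carrier one;
  carrierP : forall k u v, carrier u -> carrier v -> carrier (k *: u + v);
  carrierM : forall u v, carrier u -> carrier v -> carrier (mul u v);
  carrier_bilinear : bilinear_for *:%R *:%R mul;
  carrier_mul1l : forall u, mul one u = u;
  carrier_mul1r : forall u, mul u one = u;
  carrier_one_neq0 : one != 0;
  carrier_mulA : forall u v w, carrier u -> carrier v -> carrier w ->
    mul u (mul v w) = mul (mul u v) w
}.

Variable S : associative_subalgebra.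

Definition carrier_pred : {pred V} := fun v => `[< carrier S v >].

Lemma carrier_zmod_closed : zmod_closed carrier_pred.
Proof.
have c0 : carrier S 0.
  have := carrierP (-1) (carrier_one S) (carrier_one S).
  by rewrite scaleN1r addNr.
split=> [|u v /asboolP cu /asboolP cv]; apply/asboolP => //.
by have := carrierP (-1) cv cu; rewrite scaleN1r addrC.
Qed.

HB.instance Definition _ := GRing.isZmodClosed.Build V carrier_pred
  carrier_zmod_closed.

Record subalg := Subalg { subalg_val : V; _ : subalg_val \in carrier_pred }.

HB.instance Definition _ := [isSub for subalg_val].
HB.instance Definition _ := [Choice of subalg by <:].
HB.instance Definition _ := [SubChoice_isSubZmodule of subalg by <:].

Lemma subalgP (u : subalg) : carrier S (\val u).
Proof. exact/asboolP/(valP u). Qed.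

Definition to_subalg v (cv : carrier S v) : subalg := Subalg (asboolT cv).

Definition subalg_one : subalg := to_subalg (carrier_one S).

Definition subalg_mul (u v : subalg) : subalg :=
  to_subalg (carrierM (subalgP u) (subalgP v)).

Lemma subalg_mulrA : associative subalg_mul.
Proof. by move=> u v w; apply/val_inj/carrier_mulA; apply: subalgP. Qed.

Lemma subalg_mul1r : left_id subalg_one subalg_mul.
Proof. by move=> u; apply/val_inj/(carrier_mul1l S). Qed.

Lemma subalg_mulr1 : right_id subalg_one subalg_mul.
Proof. by move=> u; apply/val_inj/(carrier_mul1r S). Qed.

Lemma subalg_mulrDl : left_distributive subalg_mul +%R.
Proof.
by move=> u v w; apply: val_inj; rewrite /= (bilinDl (carrier_bilinear S)).
Qed.

Lemma subalg_mulrDr : right_distributive subalg_mul +%R.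
Proof.
by move=> u v w; apply: val_inj; rewrite /= (bilinDr (carrier_bilinear S)).
Qed.

Lemma subalg_oner_neq0 : subalg_one != 0.
Proof.
apply: contraNneq (carrier_one_neq0 S) => /(congr1 val) /= ->; exact: eqxx.
Qed.

HB.instance Definition _ := GRing.Zmodule_isNzRing.Build subalg
  subalg_mulrA subalg_mul1r subalg_mulr1 subalg_mulrDl subalg_mulrDr
  subalg_oner_neq0.

Lemma carrierZ k v : carrier S v -> carrier S (k *: v).
Proof.
move=> cv; have := carrierP (k - 1) cv cv.
by rewrite scalerBl scale1r subrK.
Qed.

Definition subalg_scale (q : rat) (u : subalg) : subalg :=
  to_subalg (carrierZ (ratr q) (subalgP u)).

Lemma subalg_scalerA p q u :
  subalg_scale p (subalg_scale q u) = subalg_scale (p * q) u.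
Proof. by apply: val_inj; rewrite /= scalerA rmorphM. Qed.

Lemma subalg_scale1r : left_id 1 subalg_scale.
Proof. by move=> u; apply: val_inj; rewrite /= rmorph1 scale1r. Qed.

Lemma subalg_scalerDr : right_distributive subalg_scale +%R.
Proof. by move=> q u v; apply: val_inj; rewrite /= scalerDr. Qed.

Lemma subalg_scalerDl u : {morph subalg_scale^~ u : p q / p + q}.
Proof. by move=> p q; apply: val_inj; rewrite /= rmorphD scalerDl. Qed.

HB.instance Definition _ := GRing.Zmodule_isLmodule.Build rat subalg
  subalg_scalerA subalg_scale1r subalg_scalerDr subalg_scalerDl.

Lemma subalg_scalerAl (q : rat) (u v : subalg) : q *: (u * v) = (q *: u) * v.
Proof. by apply: val_inj; rewrite /= (bilinZl (carrier_bilinear S)). Qed.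

Lemma subalg_scalerAr (q : rat) (u v : subalg) : q *: (u * v) = u * (q *: v).
Proof. by apply: val_inj; rewrite /= (bilinZr (carrier_bilinear S)). Qed.

HB.instance Definition _ := GRing.Lmodule_isLalgebra.Build rat subalg
  subalg_scalerAl.
HB.instance Definition _ := GRing.Lalgebra_isAlgebra.Build rat subalg
  subalg_scalerAr.

End AssociativeSubalgebra.

(** * Transport of the series along semilinear morphisms *)

(** The field morphism [sigma] allows both the inclusion of a rational
subalgebra into an algebra over a larger field and ordinary linear maps. *)
Section AlgebraMorphism.
Variables (F1 F2 : fieldType) (V1 : lmodType F1) (V2 : lmodType F2).
Variables (sigma : {rmorphism F1 -> F2}) (phi : {additive V1 -> V2}).
Hypothesis phiZ : forall k u, phi (k *: u) = sigma k *: phi u.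

Lemma tree_bracket_morph (br1 : V1 -> V1 -> V1) (br2 : V2 -> V2 -> V2) x y T :
  {morph phi : u v / br1 u v >-> br2 u v} ->
  phi (tree_bracket br1 x y T) = tree_bracket br2 (phi x) (phi y) T.
Proof. by move=> phi_br; elim: T => //= l <- r <-; apply: phi_br. Qed.

Lemma tree_component_morph (br1 : V1 -> V1 -> V1) (br2 : V2 -> V2 -> V2)
    alpha n x y :
  {morph phi : u v / br1 u v >-> br2 u v} ->
  phi (tree_component br1 alpha n x y) =
  tree_component br2 alpha n (phi x) (phi y).
Proof.
move=> phi_br; rewrite /tree_component !fsbig_finite; try exact: finite_trees.
rewrite raddf_sum; apply: eq_bigr => T _.
by rewrite phiZ fmorph_rat (tree_bracket_morph _ _ _ phi_br).
Qed.

Lemma commutator_morph (mul1 : V1 -> V1 -> V1) (mul2 : V2 -> V2 -> V2) :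
  {morph phi : u v / mul1 u v >-> mul2 u v} ->
  {morph phi : u v / commutator_bracket mul1 u v >-> commutator_bracket mul2 u v}.
Proof. by move=> phiM u v; rewrite raddfB !phiM. Qed.

Lemma log_exp_exp_morph (mul1 : V1 -> V1 -> V1) (mul2 : V2 -> V2 -> V2)
    one1 one2 x y n :
  {morph phi : u v / mul1 u v >-> mul2 u v} -> phi one1 = one2 ->
  phi (log_exp_exp mul1 one1 x y n) =
  log_exp_exp mul2 one2 (phi x) (phi y) n.
Proof.
move=> phiM phi1.
have phi_mul f1 f2 g1 g2 : phi \o f1 =1 f2 -> phi \o g1 =1 g2 ->
    phi \o fps_mul mul1 f1 g1 =1 fps_mul mul2 f2 g2.
  move=> ef eg m; rewrite /= raddf_sum; apply: eq_bigr => i _.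
  by rewrite phiM -ef -eg.
have phi_exp z : phi \o fps_exp mul1 one1 z =1 fps_exp mul2 one2 (phi z).
  move=> m; rewrite /= phiZ fmorphV rmorph_nat; congr (_ *: _).
  by elim: m => //= m <-; apply: phiM.
have phi_one : phi \o fps_one one1 =1 fps_one one2.
  by move=> m; rewrite /= /fps_one; case: ifP => _ //; rewrite raddf0.
have phi_pow f1 f2 m : phi \o f1 =1 f2 ->
    phi \o fps_pow mul1 one1 f1 m =1 fps_pow mul2 one2 f2 m.
  by move=> ef; elim: m => //= m IH; apply: phi_mul.
rewrite /log_exp_exp /fps_log raddf_sum; apply: eq_bigr => m _.
rewrite phiZ fmorph_div rmorphXn rmorphN1 rmorph_nat; congr (_ *: _).
apply: phi_pow => j; rewrite /= raddfB; congr (_ - _); last exact: phi_one.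
by apply: phi_mul.
Qed.

End AlgebraMorphism.

(** * The BCH series in a unital alternative algebra *)

Section GeneratedSubalgebra.
Variables (F : numFieldType) (V : lmodType F) (mul : V -> V -> V) (one x y : V).
Hypothesis mul_alt : alternative mul.
Hypotheses (mul1l : forall u, mul one u = u) (mul1r : forall u, mul u one = u).
Hypothesis one_neq0 : one != 0.

Local Notation word T := (tree_bracket mul x y T).

Let mul_bilinear : bilinear_for *:%R *:%R mul.
Proof. by have [] := mul_alt. Qed.

(** The span of the unit and the words.  As a span, it lets trilinearity reduce
the vanishing of the associator to words. *)
Inductive generated : V -> Prop :=
| generated_one : generated one
| generated_word T : generated (word T)
| generatedP k u v : generated u -> generated v -> generated (k *: u + v).

Lemma generatedM u v : generated u -> generated v -> generated (mul u v).
Proof.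
move=> gu gv; elim: gu => [|T|k u1 u2 _ IH1 _ IH2]; first by rewrite mul1l.
  elim: gv => [|T'|k v1 v2 _ IH1 _ IH2].
  - by rewrite mul1r; apply: generated_word.
  - exact: (generated_word (Node T T')).
  - by rewrite (bilinPr mul_bilinear); apply: generatedP.
by rewrite (bilinPl mul_bilinear); apply: generatedP.
Qed.

Lemma generated_associator u v w : generated u -> generated v -> generated w ->
  associator mul u v w = 0.
Proof.
move=> gu gv gw; elim: gu => [|T1|k u1 u2 _ IH1 _ IH2].
- by rewrite /associator !mul1l subrr.
- elim: gv => [|T2|k v1 v2 _ IH1 _ IH2].
  + by rewrite /associator mul1l mul1r subrr.
  + elim: gw => [|T3|k w1 w2 _ IH1 _ IH2].
    * by rewrite /associator !mul1r subrr.
    * exact: word_associator.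
    * by rewrite associatorPr // IH1 IH2 scaler0 addr0.
  + by rewrite associatorPm // IH1 IH2 scaler0 addr0.
- by rewrite associatorPl // IH1 IH2 scaler0 addr0.
Qed.

Definition generated_subalgebra : associative_subalgebra mul one.
Proof.
exists generated => //; [exact: generated_one|exact: generatedP|
  exact: generatedM|].
by move=> u v w gu gv gw; apply/esym/associator0/generated_associator.
Defined.

(** Artin's theorem makes the universal associative identity available in the
subalgebra generated by [x] and [y], where both sides of it lie. *)
Theorem BCH_alternative alpha n : BCH_coefficients alpha -> (0 < n)%N ->
  log_exp_exp mul one x y n =
  tree_component (commutator_bracket mul) alpha n x y.
Proof.
move=> alpha_BCH n0; pose D := subalg generated_subalgebra.
pose X : D := to_subalg (generated_word LeafX : carrier generated_subalgebra _).
pose Y : D := to_subalg (generated_word LeafY : carrier generated_subalgebra _).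
pose phi : {additive D -> V} := val.
have phiZ (k : rat) (u : D) : phi (k *: u) = ratr k *: phi u by [].
have phiM : {morph phi : u v / u * v >-> mul u v} by [].
have := congr1 phi (alpha_BCH D X Y n n0).
rewrite (log_exp_exp_morph phiZ (one2 := one) _ _ _ phiM) //.
by rewrite (tree_component_morph phiZ _ _ _ _ (commutator_morph phiM)).
Qed.

End GeneratedSubalgebra.

(** * Adjoining a unit *)

Section Unitization.
Variables (F : fieldType) (A : lmodType F) (mul : A -> A -> A).
Hypothesis mul_alt : alternative mul.

Let mul_bilinear : bilinear_for *:%R *:%R mul.
Proof. by have [] := mul_alt. Qed.

Local Notation U := (unitization A).
Local Notation umul := (unitization_mul mul).

Lemma unitization_mul1l (u : U) : umul (unitization_one A) u = u.
Proof.
case: u => k a; congr pair; rewrite /= ?mul1r //.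
by rewrite scale1r scaler0 (bilin0l mul_bilinear) !addr0.
Qed.

Lemma unitization_mul1r (u : U) : umul u (unitization_one A) = u.
Proof.
case: u => k a; congr pair; rewrite /= ?mulr1 //.
by rewrite scale1r scaler0 (bilin0r mul_bilinear) add0r addr0.
Qed.

Lemma unitization_one_neq0 : unitization_one A != 0.
Proof. by apply/eqP => -[/eqP]; rewrite oner_eq0. Qed.

Lemma unitization_bilinear : bilinear_for *:%R *:%R umul.
Proof.
split=> w k u v; congr pair; rewrite /=.
- by rewrite mulrDl -scalerAl.
- rewrite (bilinPl mul_bilinear) !scalerDr scalerDl !scalerA.
  by rewrite (mulrC w.1) [LHS](AC (2*2*2) (1*3*5*(2*4*6))).
- by rewrite mulrDr -scalerAr.
- rewrite (bilinPr mul_bilinear) !scalerDr scalerDl !scalerA.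
  by rewrite (mulrC k) [LHS](AC (2*2*2) (1*3*5*(2*4*6))).
Qed.

Lemma unitization_alternative : alternative umul.
Proof.
have bE := (bilinDl mul_bilinear, bilinDr mul_bilinear,
            bilinZl mul_bilinear, bilinZr mul_bilinear).
split; first exact: unitization_bilinear.
- have [_ la _] := mul_alt; case=> [a u] [b v]; congr pair; rewrite /= ?mulrA //.
  rewrite !bE la !scalerDr !scalerA (mulrC b).
  by rewrite [LHS](AC (1*3*3) (1*2*5*3*(6*4*7))).
- have [_ _ ra] := mul_alt; case=> [a u] [b v]; congr pair; rewrite /= ?mulrA //.
  rewrite !bE ra !scalerDr !scalerA (mulrC b).
  by rewrite [LHS](AC (1*3*3) (1*2*5*3*(4*6*7))).
Qed.

Lemma unitization_in_linear : linear (@unitization_in F A).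
Proof. by move=> k a b; congr pair; rewrite /= scaler0 addr0. Qed.

HB.instance Definition _ := GRing.isLinear.Build F A U *:%R
  (@unitization_in F A) unitization_in_linear.

Lemma unitization_inM a b :
  unitization_in (mul a b) = umul (unitization_in a) (unitization_in b).
Proof. by congr pair; rewrite /= ?mulr0 // !scale0r !add0r. Qed.

End Unitization.

(** * The BCH series in a special algebra *)

Lemma special_BCH (F : numFieldType) (g A : lmodType F) (br : g -> g -> g)
    (mul : A -> A -> A) (iota : {linear g -> A}) alpha n x y :
  special_embedding br mul iota -> BCH_coefficients alpha -> (0 < n)%N ->
  unitization_in (iota (tree_component br alpha n x y)) =
  log_exp_exp (unitization_mul mul) (unitization_one A)
    (unitization_in (iota x)) (unitization_in (iota y)) n.
Proof.
move=> [mul_alt _ iota_br] alpha_BCH n0.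
rewrite (BCH_alternative _ _ (unitization_alternative mul_alt) _ _ _ alpha_BCH);
  rewrite ?unitization_one_neq0 //; first last.
- exact: unitization_mul1r.
- exact: unitization_mul1l.
have iota_morph : {morph iota : u v / br u v >-> commutator_bracket mul u v}.
  by move=> u v; apply: iota_br.
have in_mul := unitization_inM mul.
have iotaZ c u : iota (c *: u) = idfun c *: iota u by rewrite linearZ.
have inZ c u : @unitization_in _ A (c *: u) = idfun c *: unitization_in u.
  by rewrite linearZ.
rewrite (tree_component_morph iotaZ _ _ _ _ iota_morph).
by rewrite (tree_component_morph inZ _ _ _ _ (commutator_morph in_mul)).
Qed.

(** * The real norm *)

Section ScalarNorm.
Variables (R : realType) (k : scalar_kind) (g : normedModType (scalar_field R k)).

Lemma scalar_reD (z w : scalar_field R k) :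
  scalar_re (z + w) = scalar_re z + scalar_re w.
Proof. by case: k z w => //= -[a b] [c d]. Qed.

Lemma scalar_re_le (z w : scalar_field R k) : z <= w -> scalar_re z <= scalar_re w.
Proof. by case: k z w => //= z w; rewrite lecE => /andP[]. Qed.

Lemma scalar_re_ratrM (q : rat) (z : scalar_field R k) :
  scalar_re (ratr q * z) = ratr q * scalar_re z.
Proof.
case: k z => //= z.
by rewrite -(fmorph_rat (real_complex R)); case: z => a b /=; rewrite mul0r subr0.
Qed.

Lemma rnorm0 : rnorm (0 : g) = 0.
Proof. by rewrite /rnorm normr0; case: k. Qed.

Lemma rnorm_ge0 (x : g) : 0 <= rnorm x.
Proof. by rewrite -rnorm0 scalar_re_le // normr0. Qed.

Lemma rnormD (x y : g) : rnorm (x + y) <= rnorm x + rnorm y.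
Proof. by rewrite -scalar_reD scalar_re_le // ler_normD. Qed.

Lemma rnorm_sum (I : Type) (r : seq I) (P : pred I) (f : I -> g) :
  rnorm (\sum_(i <- r | P i) f i) <= \sum_(i <- r | P i) rnorm (f i).
Proof.
elim/big_rec2: _ => [|i u v _ le_uv]; first by rewrite rnorm0.
by apply: le_trans (rnormD _ _) _; rewrite lerD2l.
Qed.

Lemma rnorm_ratrZ (q : rat) (x : g) :
  rnorm ((ratr q : scalar_field R k) *: x) = `|ratr q| * rnorm x.
Proof. by rewrite /rnorm normrZ -!ratr_norm scalar_re_ratrM. Qed.

End ScalarNorm.

(** * Convergence *)

(** The trees of height less than [n].  Enumerated by height rather than by
number of leaves, the sums over trees satisfy a one-step recursion. *)
Fixpoint trees (n : nat) : seq btree :=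
  if n is m.+1 then
    LeafX :: LeafY :: [seq Node l r | l <- trees m, r <- trees m]
  else [::].

Lemma trees_uniq n : uniq (trees n).
Proof.
elim: n => //= n IH; rewrite inE negb_or -!andbA; apply/and4P; split=> //.
- exact/eqP.
- by apply/negP => /allpairsPdep[? [? []]].
- by apply/negP => /allpairsPdep[? [? []]].
- by apply: allpairs_uniq => // -[a b] [c d] _ _ /= [-> ->].
Qed.

Lemma mem_trees n T : (leaves T <= n)%N -> T \in trees n.
Proof.
elim: n T => [|n IH] T; first by rewrite leqNgt leaves_gt0.
case: T => [||l r] /= le_n; rewrite !inE ?eqxx ?orbT //.
apply/orP; right; apply/orP; right; apply: allpairs_f; apply: IH.
  by move: (leaves_gt0 r); lia.
by move: (leaves_gt0 l); lia.
Qed.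

Lemma tree_componentE (F : fieldType) (V : lmodType F) (br : V -> V -> V)
    alpha m n x y : (n <= m)%N ->
  tree_component br alpha n x y =
  \sum_(T <- trees m | leaves T == n) ratr (alpha T) *: tree_bracket br x y T.
Proof.
move=> le_nm; rewrite bigfs ?trees_uniq //.
  by apply: eq_fsbigl; apply/seteqP; split=> T /= /eqP.
by move=> T /eqP sz_T; rewrite mem_trees // sz_T.
Qed.

Section TreeSums.
Variables (R : realFieldType) (w : btree -> R).
Hypothesis w_ge0 : forall T, 0 <= w T.
Hypothesis w_node : forall l r, w (Node l r) <= w l * w r.

(** The sums satisfy [P (n+1) <= t + P n ^ 2] with [t <= 1/4], and 1/2 is the
fixed point of [p |-> 1/4 + p ^ 2]. *)
Lemma tree_weights_le n : w LeafX + w LeafY <= 1 / 4 ->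
  \sum_(T <- trees n) w T <= 1 / 2.
Proof.
move=> le4; elim: n => [|n IH]; first by rewrite big_nil divr_ge0.
rewrite /= !big_cons big_allpairs_dep /=.
set s := \sum_(T <- trees n) w T in IH.
have s0 : 0 <= s by apply: sumr_ge0.
suff : \sum_(l <- trees n) \sum_(r <- trees n) w (Node l r) <= s * s by nra.
rewrite /s mulr_suml; apply: ler_sum => l _.
by rewrite mulr_sumr; apply: ler_sum => r _.
Qed.

End TreeSums.

(** Every tree occurs in at most one component, so partial sums of the norms
are bounded by [K] times the sum of the norms of all brackets of trees. *)
Lemma tree_components_summable (R : realType) (k : scalar_kind)
    (g : normedModType (scalar_field R k)) (br : g -> g -> g) (B K : R)
    (alpha : btree -> rat) (x y : g) :
  (forall u v, rnorm (br u v) <= B * rnorm u * rnorm v) ->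
  (forall T, `|(ratr (alpha T) : R)| <= K) ->
  B * (rnorm x + rnorm y) < 1 / 4 ->
  (\sum_(1 <= n <oo) (rnorm (tree_component br alpha n x y))%:E < +oo)%E.
Proof.
move=> br_bound alpha_bound lt4.
set s := rnorm x + rnorm y in lt4.
have s0 : 0 <= s by rewrite addr_ge0 ?rnorm_ge0.
have K0 : 0 <= K := le_trans (normr_ge0 _) (alpha_bound LeafX).
(* [B] may vanish or be negative; a positive bound can be divided by. *)
pose C := Num.max B (1 / (4 * (s + 1))).
have C0 : 0 < C by rewrite lt_max orbC divr_gt0 // mulr_gt0 // ltr_wpDl.
have C_s : C * s <= 1 / 4.
  rewrite /C maxr_pMl // ge_max (ltW lt4) /= mulrAC mul1r.
  by rewrite ler_pdivrMr; lra.
pose w T := C * rnorm (tree_bracket br x y T).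
have w0 T : 0 <= w T by rewrite mulr_ge0 ?rnorm_ge0 // ltW.
have w_node l r : w (Node l r) <= w l * w r.
  rewrite /w /= -mulrA ler_pM2l // mulrCA mulrA.
  apply: le_trans (br_bound _ _) _; rewrite -!mulrA ler_wpM2r ?le_max ?lexx //.
  by rewrite mulr_ge0 ?rnorm_ge0.
have W n : \sum_(T <- trees n) w T <= 1 / 2.
  by apply: tree_weights_le => //; rewrite /w /= -mulrDr.
have bound m : \sum_(1 <= n < m) rnorm (tree_component br alpha n x y) <=
    K * (1 / 2 / C).
  apply: (@le_trans _ _ (\sum_(1 <= n < m)
      \sum_(T <- trees m | leaves T == n) K * (w T / C))).
    rewrite [leLHS]big_nat [leRHS]big_nat; apply: ler_sum => n /andP[_ /ltnW le_nm].
    rewrite (@tree_componentE _ _ _ _ m) //.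
    apply: le_trans (rnorm_sum _ _ _) _; apply: ler_sum => T _.
    rewrite rnorm_ratrZ /w mulrAC mulfV ?gt_eqF // mul1r.
    by rewrite ler_wpM2r ?rnorm_ge0.
  under eq_bigr do rewrite big_mkcond.
  rewrite exchange_big /=.
  apply: (@le_trans _ _ (\sum_(T <- trees m) K * (w T / C))).
    apply: ler_sum => T _; rewrite -big_mkcond.
    under eq_bigl do rewrite eq_sym.
    rewrite big_nat1_eq; case: ifP => // _.
    by rewrite mulr_ge0 // divr_ge0 // ltW.
  rewrite -mulr_sumr ler_wpM2l // -mulr_suml ler_wpM2r ?invr_ge0 ?W //.
  exact: ltW.
apply: (@le_lt_trans _ _ (K * (1 / 2 / C))%:E); last exact: ltry.
apply: lime_le.
  by apply: is_cvg_nneseries => n _ _; rewrite lee_fin rnorm_ge0.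
by apply: nearW => m; rewrite sumEFin lee_fin.
Qed.

Unset Implicit Arguments.
Set Strict Implicit.

(** * The theorem *)

Theorem theorem3p2 (R : realType) (k : scalar_kind)
    (g : completeNormedModType (scalar_field R k)) (br : g -> g -> g)
    (br_malcev : malcev br)
    (br_continuous : continuous (fun p : g * g => br p.1 p.2))
    (A : lmodType (scalar_field R k)) (mul : A -> A -> A) (iota : {linear g -> A})
    (g_special : special_embedding br mul iota)
    (B : R) (br_bound : forall x y : g,
       rnorm (br x y) <= B * rnorm x * rnorm y)
    (alpha : btree -> rat) (alpha_BCH : BCH_coefficients alpha)
    (K : R) (K_ge1 : 1 <= K)
    (alpha_bound : forall T : btree, `|(ratr (alpha T) : R)| <= K) :
  (forall x y : g, B * (rnorm x + rnorm y) < 1 / (4 * K) ->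
     BCH_converges_absolutely br mul iota alpha x y) /\
  (forall r : R, 0 < r -> r < 1 / (4 * K) ->
     forall x y : g, B * (rnorm x + rnorm y) <= r ->
       BCH_converges_absolutely br mul iota alpha x y).
Proof.
have converges x y : B * (rnorm x + rnorm y) < 1 / (4 * K) ->
    BCH_converges_absolutely br mul iota alpha x y.
  move=> lt4K; split; first by move=> n; apply: special_BCH.
  apply: tree_components_summable br_bound alpha_bound _.
  apply: lt_le_trans lt4K _.
  by rewrite !div1r lef_pV2 ?posrE ?ler_peMr ?mulr_gt0 // (lt_le_trans ltr01).
split=> // r _ lt_r x y le_r; apply: converges; exact: le_lt_trans lt_r.
Qed.
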